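(* Let $T\ge 1$ be an integer, let $\beta_1,\dots,\beta_T\in(0,1)$, and put $\alpha_s=\prod_{i=1}^{s}(1-\beta_i)$ for $1\le s\le T$. Let $0<\eta<1$ and let $t$ be an integer with $0\le t\le T-1$. Assume $\epsilon_\theta(x_t,t)\sim\mathcal N(\mu,\sigma^2)$, let $z\sim\mathcal N(0,1)$ be independent of $\epsilon_\theta(x_t,t)$, and define $$\epsilon_{DA}=\frac{1}{\sqrt{1-\alpha_{t+1}}}\left(\sqrt{1-\alpha_{t+1}-\eta\beta_{t+1}}\;\epsilon_\theta(x_t,t)+\sqrt{\eta\beta_{t+1}}\;z\right).$$ Then $\epsilon_{DA}\sim\mathcal N(\mu_{\epsilon_{DA}},\sigma^2_{\epsilon_{DA}})$, where $$\mu_{\epsilon_{DA}}=\frac{\sqrt{1-\alpha_{t+1}-\eta\beta_{t+1}}}{\sqrt{1-\alpha_{t+1}}}\,\mu,\qquad \sigma^2_{\epsilon_{DA}}=1+\frac{1-\alpha_{t+1}-\eta\beta_{t+1}}{1-\alpha_{t+1}}\,(\sigma^2-1).$$ Thus $$\Vert\mu_{\epsilon_{DA}}\Vert<\Vert\mu\Vert,\qquad \Vert\sigma^2_{\epsilon_{DA}}-1\Vert<\Vert\sigma^2-1\Vert,$$ which indicates that after adding the random disturbance, $\epsilon_{DA}$ becomes closer to $\mathcal N(0,1)$.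
   Context: The sequence $(\beta_s)_{s=1}^T$ is the predefined variance schedule of a diffusion model. The variable $\epsilon_\theta(x_t,t)$ is the noise predicted by the model's neural network from the noisy image $x_t$ at time-step $t$, treated here as a (scalar) Gaussian random variable with mean $\mu$ and variance $\sigma^2$; $\Vert\cdot\Vert$ is then the absolute value. The variable $z$ is freshly sampled noise (the random disturbance). The parameter $\eta$ controls the proportion of random disturbance. The variable $\epsilon_{DA}$ is the effective predicted noise in one step of ''Distortion Adaptive Inversion'', i.e. the iteration $x_{t+1}=\sqrt{\alpha_{t+1}}\,f_\theta(x_t,t)+\sqrt{1-\alpha_{t+1}-\eta\beta_{t+1}}\,\epsilon_\theta(x_t,t)+\sqrt{\eta\beta_{t+1}}\,z$, where $f_\theta(x_t,t)=(x_t-\sqrt{1-\alpha_t}\,\epsilon_\theta(x_t,t))/\sqrt{\alpha_t}$ (with $\alpha_0=1$) is the prediction of the clean image. The notation $\mathcal N(m,v)$ denotes the Gaussian distribution with mean $m$ and variance $v$.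
   Formalization: The strict inequality for the mean is stated only when μ ≠ 0, and the one for the variance only when σ² ≠ 1; in the excluded cases both sides equal 0, so the strict inequality as written fails there. *)

(* Defs.v *)
From HB Require Import structures.
From mathcomp Require Import all_boot all_order all_algebra.
From mathcomp Require Import all_classical all_reals all_analysis.

Set Implicit Arguments.
Unset Strict Implicit.
Unset Printing Implicit Defensive.

Import Order.TTheory GRing.Theory Num.Theory.
Import numFieldNormedType.Exports.

Local Open Scope classical_set_scope.
Local Open Scope ring_scope.

Section gaussian_law.
Context {R : realType}.

(* N(m, v), parametrised by the variance v. The degenerate case v = 0 is the
   point mass at m: the library's [normal_prob m s] takes the standard deviation
   and is by convention the uniform law on [0, 1] when s = 0. *)
Definition gaussian (m v : R) : set R -> \bar R :=
  if 0 < v then normal_prob m (Num.sqrt v) else \d_m.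

Context d (Omega : measurableType d) (P : probability Omega R).

(* The two laws are compared on Borel sets only: [distribution P X] is a total
   set function, whose values elsewhere are meaningless. *)
Definition has_gaussian_law (X : {RV P >-> R}) (m v : R) : Prop :=
  0 <= v /\
  forall A : set R, measurable A -> distribution P X A = gaussian m v A.

Definition independent_RV2 (X Y : {RV P >-> R}) : Prop :=
  forall A B : set R, measurable A -> measurable B ->
    P (X @^-1` A `&` Y @^-1` B) = (P (X @^-1` A) * P (Y @^-1` B))%E.

End gaussian_law.

Section distortion_adaptive_inversion.
Context {R : realType}.
Implicit Types (beta : nat -> R) (eta : R) (s t : nat).

(* Only beta_1, beta_2, ... matter; beta 0 is never used. *)
Definition alpha beta s : R := \prod_(1 <= i < s.+1) (1 - beta i).

Definition mu_DA beta eta t (mu : R) : R :=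
  Num.sqrt (1 - alpha beta t.+1 - eta * beta t.+1)
    / Num.sqrt (1 - alpha beta t.+1) * mu.

Definition sigma2_DA beta eta t (sigma2 : R) : R :=
  1 + (1 - alpha beta t.+1 - eta * beta t.+1) / (1 - alpha beta t.+1)
      * (sigma2 - 1).

Context d (Omega : measurableType d) (P : probability Omega R).

(* The noise of one step
     x_{t+1} = sqrt alpha_{t+1} * f_theta (x_t, t)
             + sqrt (1 - alpha_{t+1} - eta * beta_{t+1}) * eps_theta (x_t, t)
             + sqrt (eta * beta_{t+1}) * z,
   rescaled so that x_{t+1} = sqrt alpha_{t+1} * f_theta (x_t, t)
                            + sqrt (1 - alpha_{t+1}) * eps_DA. *)
Definition eps_DA beta eta t (eps z : {RV P >-> R}) : {RV P >-> R} :=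
  (Num.sqrt (1 - alpha beta t.+1))^-1 *:
    (Num.sqrt (1 - alpha beta t.+1 - eta * beta t.+1) *: eps
     + Num.sqrt (eta * beta t.+1) *: z).

End distortion_adaptive_inversion.

(* Main.v *)
(* A Gaussian density with independent Gaussian translation stays Gaussian: for
   b > 0 the law of a X + b Z given X = x has density w |-> pdf_(a x, b)(w), so
   by Tonelli a X + b Z has density w |-> E[pdf_(a X, b)(w)]. Completing the
   square in x turns pdf_(a x, b)(w) pdf_(m, s)(x) into pdf_(a m, S)(w), with
   S^2 = a^2 s^2 + b^2, times a Gaussian density in x, which integrates to 1.
   For eps_DA, a^2 + b^2 = 1, so the variance minus 1 is scaled by a^2, and
   0 < a^2 < 1 since alpha_(t+1) <= 1 - beta_(t+1) and 0 < eta < 1. *)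
Require Import Defs.
From HB Require Import structures.
From mathcomp Require Import all_boot all_order all_algebra.
From mathcomp Require Import all_classical all_reals all_analysis.
From mathcomp Require Import measurable_realfun ring lra.

Set Implicit Arguments.
Unset Strict Implicit.
Unset Printing Implicit Defensive.

Import Order.TTheory GRing.Theory Num.Theory.
Import numFieldNormedType.Exports.

Local Open Scope classical_set_scope.
Local Open Scope ring_scope.

(** * Affine images and convolution of normal laws *)

Section normal_law.
Context {R : realType}.
Local Notation leb := (@lebesgue_measure R).

Lemma measurable_affine (b c : R) :
  measurable_fun setT
    (fun y : measurableTypeR R => b * y + c : measurableTypeR R).
Proof. by apply: measurable_funD => //; exact: measurable_funM. Qed.

(** Uniqueness of Lebesgue measure: the right-hand side is a measure in [A] that gives []u, v]] its
    length. *)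
Lemma lebesgue_measure_affine (b c : R) (A : set R) : 0 < b -> measurable A ->
  leb A = (b%:E * leb [set y | A (b * y + c)%R])%E.
Proof.
move=> b0 mA.
pose phi := fun y : measurableTypeR R => b * y + c : measurableTypeR R.
have mphi : measurable_fun setT phi by exact: measurable_affine.
pose phi' : {mfun measurableTypeR R >-> measurableTypeR R} :=
  HB.pack phi (isMeasurableFun.Build _ _ _ _ _ mphi).
rewrite (@lebesgue_measure_unique R
  (mscale (NngNum (ltW b0)) (pushforward leb phi')))// => _ [[u v] _ <-] /=.
rewrite /mscale /pushforward /=.
rewrite [X in (_ * leb X)%E](_ : _ =
    `](u - c) / b, (v - c) / b]%classic); last first.
  apply/seteqP; split => y; rewrite /= !in_itv /= /phi.
    by rewrite ltr_pdivrMr// ler_pdivlMr// ltrBlDr lerBrDr (mulrC y).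
  by rewrite ltr_pdivrMr// ler_pdivlMr// ltrBlDr lerBrDr (mulrC y).
rewrite !lebesgue_measure_itv/= !lte_fin ltr_pM2r ?invr_gt0// ltrD2r.
case: ifPn => _; last by rewrite mule0.
rewrite -!EFinB -EFinM; congr EFin.
by field; rewrite gt_eqF.
Qed.

Lemma normal_pdf_center (m s x : R) : s != 0 ->
  normal_pdf m s x = normal_pdf 0 s (x - m).
Proof. by move=> s0; rewrite !normal_pdfE// /normal_fun subr0. Qed.

Lemma normal_pdf_affine (b c y : R) : 0 < b ->
  b * normal_pdf c b (b * y + c) = normal_pdf 0 1 y.
Proof.
move=> b0; have bn0 : b != 0 by rewrite gt_eqF.
rewrite !normal_pdfE ?oner_neq0// mulrA; congr (_ * _).
  rewrite /normal_peak -mulrnAr sqrtrM ?sqr_ge0// sqrtr_sqr gtr0_norm//.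
  by rewrite invfM mulrA divff// expr1n !mul1r.
rewrite /normal_fun; congr expR.
by field; rewrite bn0.
Qed.

Lemma ge0_integral_affine (b c : R) (A : set (measurableTypeR R))
    (f : measurableTypeR R -> \bar R) : 0 < b -> measurable A ->
    measurable_fun A f -> (forall x, 0 <= f x)%E ->
  (\int[leb]_(x in A) f x =
   b%:E * \int[leb]_(y in [set y | A (b * y + c)%R]) f (b * y + c)%R)%E.
Proof.
move=> b0 mA mf f0; have mphi := measurable_affine b c.
set phi := (X in measurable_fun _ X) in mphi.
rewrite -(@ge0_integral_pushforward _ _ _ _ _ _ mphi leb A f)//.
rewrite -[X in (X%:E * _)%E]/((NngNum (ltW b0))%:num) -ge0_integral_mscale//.
by apply: eq_measure_integral => B mB _; exact: lebesgue_measure_affine.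
Qed.

Lemma normal_prob_affine (b c : R) (A : set R) : 0 < b -> measurable A ->
  normal_prob 0 1 [set y | A (b * y + c)] = normal_prob c b A.
Proof.
move=> b0 mA; rewrite /normal_prob [RHS](@ge0_integral_affine b c)//=.
- rewrite -ge0_integralZl//=.
  + by apply: eq_integral => y _; rewrite -EFinM normal_pdf_affine.
  + by rewrite -[X in measurable X]setTI; exact: measurable_affine.
  + apply/measurable_EFinP/measurable_funTS.
    apply: measurableT_comp; first exact: measurable_normal_pdf.
    exact: measurable_affine.
  + by move=> y _; rewrite lee_fin normal_pdf_ge0.
  + by rewrite lee_fin ltW.
- by apply/measurable_EFinP/measurable_funTS; exact: measurable_normal_pdf.
- by move=> x; rewrite lee_fin normal_pdf_ge0.
Qed.

(** Bayes' rule for W = a X + b Z: the joint density of (X, W) is the density of W times that of X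
    given W = w. The latter has precision 1/s^2 + a^2/b^2 = S^2/(s b)^2, and its mean weighs m and w
    accordingly. *)
Lemma normal_pdf_mul (m s a b w x : R) : 0 < s -> 0 < b ->
  let S := Num.sqrt (a ^+ 2 * s ^+ 2 + b ^+ 2) in
  normal_pdf (a * x) b w * normal_pdf m s x =
  normal_pdf (a * m) S w *
    normal_pdf ((m * b ^+ 2 + a * s ^+ 2 * w) / S ^+ 2) (s * b / S) x.
Proof.
move=> s0 b0 S.
have S20 : 0 < a ^+ 2 * s ^+ 2 + b ^+ 2.
  by rewrite ltr_wpDl ?exprn_gt0// mulr_ge0 ?sqr_ge0.
have S0 : 0 < S by rewrite sqrtr_gt0.
have SE : S ^+ 2 = a ^+ 2 * s ^+ 2 + b ^+ 2 by rewrite sqr_sqrtr// ltW.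
have sn0 : s != 0 by rewrite gt_eqF.
have bn0 : b != 0 by rewrite gt_eqF.
have Sn0 : S != 0 by rewrite gt_eqF.
have sbS0 : s * b / S != 0 by rewrite !mulf_neq0 ?invr_eq0.
have S2n0 : a ^+ 2 * s ^+ 2 + b ^+ 2 != 0 by rewrite gt_eqF.
rewrite !normal_pdfE// mulrACA [RHS]mulrACA; congr (_ * _).
  rewrite /normal_peak -!invfM -!sqrtrM ?mulrn_wge0 ?mulr_ge0 ?sqr_ge0
    ?pi_ge0 ?(ltW b0) ?(ltW S0)//.
  by congr (Num.sqrt _)^-1; field.
rewrite /normal_fun -!expRD; congr expR.
rewrite !expr_div_n SE.
by field; rewrite exprMn S2n0 bn0 sn0.
Qed.

Lemma integral_normal_prob (m s : R) (f : R -> \bar R) :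
  (normal_prob m s).-integrable setT f ->
  (\int[normal_prob m s]_x f x = \int[leb]_x (f x * (normal_pdf m s x)%:E))%E.
Proof.
move=> intf; have mf := measurable_int _ intf.
rewrite -(Radon_Nikodym_change_of_variables (normal_prob_dominates m s))//=.
apply: ae_eq_integral => //.
- by apply: emeasurable_funM => //; apply: measurable_int;
    apply: Radon_Nikodym_integrable; exact: normal_prob_dominates.
- apply: emeasurable_funM => //=; apply/measurable_EFinP.
  exact: measurable_normal_pdf.
(* The Radon-Nikodym derivative and [normal_pdf] have the same integral over every measurable set,
   so they agree almost everywhere. *)
- apply: ae_eqe_mul2l => /=.
  rewrite Radon_NikodymE//=; first exact: normal_prob_dominates.
  move=> dom; case: cid => /= h [h1 h2 h3].
  apply: integral_ae_eq => //=.
  + by apply/measurable_EFinP; exact: measurable_normal_pdf.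
  + by move=> E _ mE; rewrite -h3.
Qed.

Lemma integral_normal_pdf_conv (m s a b w : R) : 0 < s -> 0 < b ->
  (\int[normal_prob m s]_x (normal_pdf (a * x) b w)%:E =
   (normal_pdf (a * m) (Num.sqrt (a ^+ 2 * s ^+ 2 + b ^+ 2)) w)%:E)%E.
Proof.
move=> s0 b0.
have bn0 : b != 0 by rewrite gt_eqF.
have mf : measurable_fun setT (fun x : R => normal_pdf (a * x) b w).
  (* Centering moves [x] from the mean to the point of evaluation, where [measurable_normal_pdf]
     applies. *)
  under eq_fun do rewrite normal_pdf_center//.
  apply: measurableT_comp; first exact: measurable_normal_pdf.
  by apply: measurable_funB => //; exact: measurable_funM.
rewrite integral_normal_prob; last first.
  apply: (@le_integrable _ _ _ _ _ _ _ (cst (normal_peak b)%:E)) => //=.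
  - exact/measurable_EFinP.
  - move=> x _; rewrite lee_fin !ger0_norm ?normal_pdf_ge0 ?normal_peak_ge0//.
    exact: normal_pdf_ub.
  - exact: finite_measure_integrable_cst.
under eq_integral do rewrite -EFinM normal_pdf_mul// EFinM.
rewrite ge0_integralZl//=.
- by rewrite integral_normal_pdf mule1.
- by apply/measurable_EFinP; exact: measurable_normal_pdf.
- by move=> x _; rewrite lee_fin normal_pdf_ge0.
- by rewrite lee_fin normal_pdf_ge0.
Qed.

End normal_law.

(** * Linear combinations of independent Gaussian variables *)

Section linear_combination.
Context {R : realType} d (Omega : measurableType d) (P : probability Omega R).
Implicit Types X Z : {RV P >-> R}.

(** Independence is agreement of the joint law with the product measure on rectangles, which
    determine the latter. *)
Lemma independent_RV2_joint X Z (C : set (R * R)) : independent_RV2 X Z ->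
  measurable C ->
  P [set w | C (X w, Z w)] = (distribution P X \x distribution P Z)%E C.
Proof.
move=> XZ mC.
have mXZ : measurable_fun setT (fun w => (X w, Z w)).
  exact: measurable_fun_pair.
pose XZ' : {mfun Omega >-> (R * R)%type} :=
  HB.pack (fun w => (X w, Z w)) (isMeasurableFun.Build _ _ _ _ _ mXZ).
rewrite (@product_measure_unique _ _ _ _ _ (distribution P X) (distribution P Z)
  (distribution P XZ'))//.
Qed.

(** As [0 < b], the sum has a density even when [X] is a point mass, so [v = 0] is covered. *)
Lemma has_gaussian_law_lin X Z (m v a b : R) : 0 < b ->
  has_gaussian_law X m v -> has_gaussian_law Z 0 1 -> independent_RV2 X Z ->
  has_gaussian_law (a *: X + b *: Z : {RV P >-> R}) (a * m)
    (a ^+ 2 * v + b ^+ 2).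
Proof.
move=> b0 [v0 HX] [_ HZ] XZ.
have bn0 : b != 0 by rewrite gt_eqF.
have V0 : 0 < a ^+ 2 * v + b ^+ 2.
  by rewrite ltr_wpDl ?exprn_gt0// mulr_ge0 ?sqr_ge0.
split=> [|A mA]; first exact: ltW.
rewrite /gaussian V0.
pose C : set (R * R) := [set p | A (a * p.1 + b * p.2)].
have mC : measurable C.
  rewrite -[C]setTI.
  have : measurable_fun setT (fun p : R * R => a * p.1 + b * p.2).
    by apply: measurable_funD; apply: measurable_funM.
  exact.
have -> : distribution P (a *: X + b *: Z : {RV P >-> R}) A =
  P [set w | C (X w, Z w)] by [].
rewrite (independent_RV2_joint XZ)// /product_measure1 /=.
(* The section of [C] at [x] is the event that b Z + a x lies in [A], and b Z + a x follows N(a x,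
   b^2). *)
have ZE x : distribution P Z (xsection C x) =
    (\int[lebesgue_measure]_w (\1_A w * normal_pdf (a * x) b w)%:E)%E.
  have -> : xsection C x = [set y | A (b * y + a * x)].
    by apply/seteqP; split=> y; rewrite /xsection /= inE /C/= addrC.
  rewrite HZ; last first.
    by rewrite -[X in measurable X]setTI; exact: measurable_affine.
  rewrite /gaussian ltr01 sqrtr1 normal_prob_affine//.
  rewrite /normal_prob integral_mkcond; apply: eq_integral => y _.
  rewrite patchE indicE; by case: (y \in A); rewrite ?mul1r ?mul0r.
under eq_integral do rewrite ZE.
pose f (p : R * R) := (\1_A p.2 * normal_pdf (a * p.1) b p.2)%:E.
have mf : measurable_fun setT f.
  rewrite /f; under eq_fun do rewrite normal_pdf_center//.
  apply/measurable_EFinP/measurable_funM.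
    by apply: measurableT_comp => //; exact: measurable_indic.
  apply: measurableT_comp; first exact: measurable_normal_pdf.
  by apply: measurable_funB => //; exact: measurable_funM.
(* After the exchange, [w] is fixed in the inner integral, so the indicator of [A] factors out. *)
rewrite (fubini_tonelli (m1 := distribution P X) (m2 := lebesgue_measure) f)//=;
  last first.
  by move=> p; rewrite lee_fin mulr_ge0 ?normal_pdf_ge0.
rewrite /normal_prob [RHS]integral_mkcond; apply: eq_integral => w _.
rewrite patchE.
under eq_integral do rewrite /f/= EFinM.
have mw : measurable_fun setT (fun x : R => (normal_pdf (a * x) b w)%:E).
  under eq_fun do rewrite normal_pdf_center//.
  apply/measurable_EFinP; apply: measurableT_comp.
    exact: measurable_normal_pdf.
  by apply: measurable_funB => //; exact: measurable_funM.
rewrite ge0_integralZl//; last first.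
  by move=> x _; rewrite lee_fin normal_pdf_ge0.
rewrite indicE; case: (w \in A); rewrite ?mul0e// mul1e.
(* It remains to average the conditional density at [w] over the law of [X]: evaluation at [m] if
   [v = 0], a normal convolution if [v > 0]. *)
move: v0; rewrite le_eqVlt => /predU1P[v0|v0].
- rewrite (eq_measure_integral (dirac m)); last first.
    by move=> B mB _; rewrite [LHS]HX// /gaussian -v0 ltxx.
  rewrite integral_dirac// diracT mul1e -v0 mulr0 add0r sqrtr_sqr.
  by rewrite gtr0_norm.
- (* [normal_prob] is a measure on [measurableTypeR R], which is not the
     measurable structure of [R] on which [distribution P X] lives. *)
  have mX : @measurable_fun _ _ Omega (measurableTypeR R) setT X.
    exact: (measurable_funPT X).
  have pdf_ge0 x : (0 <= (normal_pdf (a * x) b w)%:E)%E.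
    by rewrite lee_fin normal_pdf_ge0.
  rewrite ge0_integral_distribution//.
  rewrite -(@ge0_integral_pushforward _ _ _ _ _ _ mX P setT)//=.
  transitivity (\int[normal_prob m (Num.sqrt v)]_x
      (normal_pdf (a * x) b w)%:E)%E.
    by apply: eq_measure_integral => B mB _; rewrite [LHS]HX// /gaussian v0.
  by rewrite integral_normal_pdf_conv ?sqrtr_gt0// sqr_sqrtr// ltW.
Qed.

End linear_combination.

(** * The variance schedule and the law of the rescaled noise *)

Lemma alpha_le (R : realType) (beta : nat -> R) (t : nat) :
  (forall s, (1 <= s <= t.+1)%N -> 0 <= beta s <= 1) ->
  alpha beta t.+1 <= 1 - beta t.+1.
Proof.
move=> hb; rewrite /alpha big_nat_recr//=.
have /andP[b0 b1] := hb t.+1 (leqnn _).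
rewrite ler_piMl ?subr_ge0// big_nat prodr_ile1// => i /andP[i1 it].
have /andP[bi0 bi1] := hb i (introT andP (conj i1 (ltnW it))).
by rewrite subr_ge0 bi1 gerBl.
Qed.

Theorem theorem1 (R : realType) (T : nat) (hT : (1 <= T)%N)
    (beta : nat -> R)
    (hbeta : forall s : nat, (1 <= s <= T)%N -> 0 < beta s < 1)
    (eta : R) (heta : 0 < eta < 1)
    (t : nat) (ht : (t <= T - 1)%N)
    (d : measure_display) (Omega : measurableType d) (P : probability Omega R)
    (mu sigma : R)
    (eps z : {RV P >-> R})
    (heps : has_gaussian_law eps mu (sigma ^+ 2))
    (hz : has_gaussian_law z 0 1)
    (hind : independent_RV2 eps z) :
  [/\ has_gaussian_law (eps_DA beta eta t eps z)
        (mu_DA beta eta t mu) (sigma2_DA beta eta t (sigma ^+ 2)),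
      (mu != 0 -> `|mu_DA beta eta t mu| < `|mu|) &
      (sigma ^+ 2 != 1 ->
        `|sigma2_DA beta eta t (sigma ^+ 2) - 1| < `|sigma ^+ 2 - 1|)].
Proof.
have tT : (t.+1 <= T)%N by rewrite -(subnKC hT) add1n ltnS.
have hb s : (1 <= s <= t.+1)%N -> 0 < beta s < 1.
  by move=> /andP[s1 st]; apply: hbeta; rewrite s1 (leq_trans st).
have /andP[b0 b1] := hb t.+1 (leqnn _).
have /andP[eta0 eta1] := heta.
have al : alpha beta t.+1 <= 1 - beta t.+1.
  by apply: alpha_le => s /hb/andP[s0 s1]; rewrite !ltW.
rewrite /mu_DA /sigma2_DA /eps_DA.
set c := 1 - alpha beta t.+1; set e := eta * beta t.+1; set k := c - e.
have e0 : 0 < e by rewrite mulr_gt0.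
(* By [al], [c] is at least [beta t.+1], which exceeds [e] because [eta < 1]. *)
have k0 : 0 < k.
  rewrite /k /c /e; have : eta * beta t.+1 < beta t.+1 by rewrite gtr_pMl.
  by lra.
have kc : k < c by rewrite /k; lra.
have c0 : 0 < c by exact: lt_trans kc.
have sc0 : 0 < Num.sqrt c by rewrite sqrtr_gt0.
have cn0 : c != 0 by rewrite gt_eqF.
split.
- rewrite scalerDr !scalerA ![_^-1 * _]mulrC.
  (* Since [k + e = c], the squared weights k/c and e/c sum to 1. *)
  have -> : 1 + k / c * (sigma ^+ 2 - 1) =
      (Num.sqrt k / Num.sqrt c) ^+ 2 * sigma ^+ 2 +
      (Num.sqrt e / Num.sqrt c) ^+ 2.
    rewrite !expr_div_n !sqr_sqrtr ?ltW// /k.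
    by field.
  by apply: has_gaussian_law_lin => //; rewrite divr_gt0 ?sqrtr_gt0.
(* Both contraction factors are below 1 as [k < c]. The premises [mu != 0] and [sigma ^+ 2 != 1]
   exclude the cases where both sides vanish and strictness fails. *)
- move=> mu0; rewrite normrM gtr0_norm ?divr_gt0 ?sqrtr_gt0//.
  by rewrite gtr_pMl ?normr_gt0// ltr_pdivrMr// mul1r ltr_sqrt.
- move=> s1; rewrite addrAC subrr add0r normrM gtr0_norm ?divr_gt0//.
  by rewrite gtr_pMl ?normr_gt0 ?subr_eq0// ltr_pdivrMr// mul1r.
Qed.
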